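(* Let $\mathcal{C}$ be a centered maximal $15$-element clique of the collinearity graph of $\mathcal{P}_4(15)$. Then one of the following possibilities is realized: (C1) $\mathcal{C}$ is a maximal singular subspace of $\mathcal{P}_4(15)$ and every point of $\mathcal{C}$ is a center point. (C2) $\mathcal{C}$ is the union of three Fano planes whose intersection is a line formed by center points; every line in $\mathcal{C}$ is contained in one of these planes. (C3) $\mathcal{C}$ contains a unique Fano plane and a unique center point belonging to this plane; every line in $\mathcal{C}$ is contained in this plane or passes through the center point. (C4) $\mathcal{C}$ contains a unique center point and every line in $\mathcal{C}$ passes through the center point. Moreover, for any two centered maximal $15$-element cliques of the same type (C1)–(C4) there is a permutation of the set $[15]=\{1,\dots,15\}$ transferring one of these cliques to the other.
   Context: $\mathcal{P}_4(15)$ is the point-line geometry whose points are all $8$-element subsets of $[15]=\{1,\dots,15\}$ and whose lines are all triples $\{X,Y,X\triangle Y\}$ such that $X,Y$ are distinct and $X,Y,X\triangle Y$ are all $8$-element subsets. Two distinct points $X,Y$ are collinear (lie on a common line) if and only if $|X\cap Y|=4$. The collinearity graph has the points as vertices, two distinct points being adjacent if and only if they are collinear. A set of points is a subspace if, together with any two collinear points in it, it contains the line joining them; a subspace is singular if any two distinct points of it are collinear. A maximal singular subspace is one maximal with respect to inclusion. A Fano plane in $\mathcal{P}_4(15)$ is a singular subspace isomorphic (with the lines it contains) to $\mathrm{PG}(2,2)$. ''A line in $\mathcal{C}$'' means a line of $\mathcal{P}_4(15)$ all of whose points belong to $\mathcal{C}$; likewise for planes. A clique is maximal if it is maximal with respect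 to inclusion. A point $O\in\mathcal{C}$ of a maximal clique $\mathcal{C}$ is a center point of $\mathcal{C}$ if for every $C\in\mathcal{C}\setminus\{O\}$ the line joining $C$ and $O$ is contained in $\mathcal{C}$, i.e. $O\triangle C\in\mathcal{C}$. A maximal clique is centered if it has at least one center point. A permutation of $[15]$ acts on subsets of $[15]$, hence on cliques. *)

(* Defs.v *)
From mathcomp Require Import all_boot all_order all_algebra all_fingroup.

Set Implicit Arguments.
Unset Strict Implicit.
Unset Printing Implicit Defensive.

(* The set [15] = {1, ..., 15} is represented by 'I_15 = {0, ..., 14}. *)

Definition symdiff (X Y : {set 'I_15}) : {set 'I_15} :=
  (X :\: Y) :|: (Y :\: X).

Definition points : {set {set 'I_15}} := [set X : {set 'I_15} | #|X| == 8].

Definition joining_line (X Y : {set 'I_15}) : {set {set 'I_15}} :=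
  [set X; Y; symdiff X Y].

Definition line (L : {set {set 'I_15}}) : bool :=
  [exists X in points, exists Y in points,
     [&& X != Y, symdiff X Y \in points & L == joining_line X Y]].

(* Any two of X, Y, symdiff X Y have the third one as symmetric difference, so
   that joining_line X Y is the only line through two distinct collinear points. *)
Definition collinear (X Y : {set 'I_15}) : bool :=
  [exists L, [&& line L, X \in L & Y \in L]].

Definition clique (C : {set {set 'I_15}}) : bool :=
  (C \subset points) &&
  [forall X in C, forall Y in C, (X != Y) ==> collinear X Y].

Definition subspace (S : {set {set 'I_15}}) : bool :=
  (S \subset points) &&
  [forall X in S, forall Y in S,
     (X != Y) && collinear X Y ==> (joining_line X Y \subset S)].

Definition singular (S : {set {set 'I_15}}) : bool :=
  subspace S &&
  [forall X in S, forall Y in S, (X != Y) ==> collinear X Y].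

Definition line_in (C L : {set {set 'I_15}}) : bool :=
  line L && (L \subset C).

Definition center_point (C : {set {set 'I_15}}) (O : {set 'I_15}) : bool :=
  (O \in C) && [forall X in C :\ O, joining_line X O \subset C].

Definition centered_max_clique15 (C : {set {set 'I_15}}) : bool :=
  [&& maxset clique C, #|C| == 15 & [exists O, center_point C O]].

(* P, with the lines it contains, is isomorphic to PG(2, 2), whose points and
   lines are the 1- and 2-dimensional subspaces of F_2^3. Only the values of f
   on 1-dimensional subspaces are relevant. *)
Definition iso_PG22 (P : {set {set 'I_15}}) : Prop :=
  exists f : {vspace 'rV['F_2]_3} -> {set 'I_15},
    [/\ forall U, \dim U = 1%N -> f U \in P,
        forall U V, \dim U = 1%N -> \dim V = 1%N -> f U = f V -> U = V,
        forall X, X \in P -> exists2 U, \dim U = 1%N & f U = X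
      & forall L : {set {set 'I_15}}, L \subset P ->
          (line L <->
           exists2 W : {vspace 'rV['F_2]_3}, \dim W = 2%N &
             forall U, \dim U = 1%N -> (f U \in L) = (U <= W)%VS)].

Definition fano_plane (P : {set {set 'I_15}}) : Prop :=
  singular P /\ iso_PG22 P.

Definition fano_in (C P : {set {set 'I_15}}) : Prop :=
  fano_plane P /\ P \subset C.

Definition typeC1 (C : {set {set 'I_15}}) : Prop :=
  maxset singular C /\ (forall O, O \in C -> center_point C O).

Definition typeC2 (C : {set {set 'I_15}}) : Prop :=
  exists P1 P2 P3 : {set {set 'I_15}},
    [/\ [/\ fano_plane P1, fano_plane P2 & fano_plane P3],
        [/\ P1 != P2, P1 != P3 & P2 != P3],
        C = P1 :|: P2 :|: P3,
        line (P1 :&: P2 :&: P3) /\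
          (forall O, O \in P1 :&: P2 :&: P3 -> center_point C O)
      & forall L, line_in C L ->
          [\/ L \subset P1, L \subset P2 | L \subset P3]].

Definition typeC3 (C : {set {set 'I_15}}) : Prop :=
  exists (P : {set {set 'I_15}}) (O : {set 'I_15}),
    [/\ fano_in C P /\ (forall Q, fano_in C Q -> Q = P),
        center_point C O /\ (forall O', center_point C O' -> O' = O),
        O \in P
      & forall L, line_in C L -> L \subset P \/ O \in L].

Definition typeC4 (C : {set {set 'I_15}}) : Prop :=
  exists O : {set 'I_15},
    [/\ center_point C O,
        forall O', center_point C O' -> O' = O
      & forall L, line_in C L -> O \in L].

Definition perm_image (s : {perm 'I_15}) (C : {set {set 'I_15}}) :
    {set {set 'I_15}} :=
  [set s @: X | X : {set 'I_15} in C].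

(* Main.v *)
Require Import Defs.
From mathcomp Require Import all_boot all_order all_algebra all_fingroup.
From mathcomp Require Import zify.

(** Let [O] be a center of the clique [C]. Any two points of [C] meet in 4
    elements, and [C] without [O] splits into 7 pairs consisting of a point [X]
    and [symdiff X O]: these have the same trace outside [O] and complementary
    traces inside [O]. Fix [x0] in [O] and keep from each pair the member that
    misses [x0]. The traces of these 7 points on [O :\ x0] and on [~: O] are
    two families of seven 4-subsets of a 7-set meeting pairwise in 2 elements.
    Adding the empty set to such a family gives a group under symmetric
    difference ([code_symdiff]), hence a copy of F_2^3, the binary simplex code
    ([simplex_code]); and the elements of the 7-set become the nonzero linear
    forms on it ([coords_separate]).

    So [C] is described by the bijection [phi] between two copies of F_2^3,
    with [phi 0 = 0], that sends the inner trace of a point to its outer trace;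
    the points become the nonzero vectors [(p, e)] of F_2^3 x F_2, the last
    coordinate telling the two members of a pair apart, and [O] is [(0, 1)].
    Two distinct points [(p, e)], [(q, f)] lie on a line inside [C] exactly if
    [phi (p + q) = phi p + phi q] ([pt_additive], [pt_sum]).

    Up to linear changes of coordinates on both sides there are only four such
    [phi] ([twist_normal_form]). If [phi] is not linear, take [u], [v] with
    [phi (u + v) <> phi u + phi v]. Then [phi u], [phi v], [phi (u + v)] form a
    basis; let [t] be the vector that [phi] sends to the sum of this basis. The
    three remaining vectors [x + t], for [x] among [u], [v], [u + v], must go to
    the three remaining values [phi t + phi y], so [phi] induces a permutation
    of [u], [v], [u + v], which matters only up to conjugacy: it is the
    identity, a transposition or a 3-cycle. The triples on which [phi] is
    additive are those of [t], [x] and [x + t] with [x] fixed by the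
    permutation, and each yields a Fano plane through [O]. Thus a linear
    [phi] gives [typeC1], and 3, 1 or 0 fixed points give [typeC2], [typeC3] or
    [typeC4] ([normal_form_typeC]).

    Cliques with the same normal form differ by a permutation of the
    coordinatized 15 elements ([normal_form_perm]). As the four types exclude
    each other ([typeC_unique]), the type determines the normal form. *)

Set Implicit Arguments.
Unset Strict Implicit.
Unset Printing Implicit Defensive.

Import GRing.Theory.
Local Open Scope ring_scope.

Ltac card_lia :=
  repeat match goal with
  | |- context [card ?A] => let n := fresh in move: (card A) => n
  end; clear; lia.

(** * Symmetric differences, lines and cliques *)

Lemma in_symdiff (X Y : {set 'I_15}) x :
  (x \in symdiff X Y) = (x \in X) (+) (x \in Y).
Proof. by rewrite !inE; case: (x \in X); case: (x \in Y). Qed.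

Lemma symdiffA : associative symdiff.
Proof. by move=> X Y Z; apply/setP => x; rewrite !in_symdiff addbA. Qed.

Lemma symdiffC : commutative symdiff.
Proof. by move=> X Y; apply/setP => x; rewrite !in_symdiff addbC. Qed.

Lemma symdiff0 X : symdiff X set0 = X.
Proof. by apply/setP => x; rewrite in_symdiff inE addbF. Qed.

Lemma symdiffXX X : symdiff X X = set0.
Proof. by apply/setP => x; rewrite in_symdiff inE addbb. Qed.

Lemma symdiffK X Y : symdiff X (symdiff X Y) = Y.
Proof. by rewrite symdiffA symdiffXX symdiffC symdiff0. Qed.

Lemma symdiffKr X Y : symdiff (symdiff X Y) Y = X.
Proof. by rewrite -symdiffA symdiffXX symdiff0. Qed.

(** In a triple closed under [symdiff], any two members determine the third. *)
Definition symdiffKs :=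
  (symdiffK, symdiffKr, fun X Y => etrans (symdiffC _ X) (symdiffK X Y),
   fun X Y => etrans (symdiffC Y _) (symdiffKr X Y)).

Lemma card_symdiff X Y : (#|symdiff X Y| + 2 * #|X :&: Y| = #|X| + #|Y|)%N.
Proof.
rewrite -(cardsID Y X) -(cardsID X Y) cardsU [Y :&: X]setIC.
suff -> : (X :\: Y) :&: (Y :\: X) = set0 by rewrite cards0; card_lia.
by apply/setP => x; rewrite !inE; case: (x \in X); case: (x \in Y).
Qed.

Lemma collinearE X Y :
  X \in points -> Y \in points -> X != Y ->
  collinear X Y = (symdiff X Y \in points).
Proof.
move=> pX pY nXY; apply/existsP/idP => [[L /and3P[]]|pXY].
  case/exists_inP=> A pA /exists_inP[B pB /and3P[nAB pAB /eqP ->]].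
  rewrite !(in_setU, in_set1) -!orbA => /or3P[] /eqP eX /or3P[] /eqP eY;
    move: pX pY nXY; rewrite {}eX {}eY ?eqxx // => _ _ _;
    by rewrite ?symdiffKs // symdiffC.
exists (joining_line X Y); rewrite !inE !eqxx ?orbT !andbT.
by apply/exists_inP; exists X => //; apply/exists_inP; exists Y => //;
  rewrite nXY pXY eqxx.
Qed.

Lemma symdiff_clique C X Y :
  clique C -> X \in C -> Y \in C -> X != Y -> symdiff X Y \in points.
Proof.
case/andP=> /subsetP sC /forall_inP cC CX CY nXY.
have /forall_inP/(_ Y CY)/implyP/(_ nXY) := cC X CX.
by rewrite collinearE // ?(sC X) ?(sC Y).
Qed.

Lemma clique_cardI C X Y :
  clique C -> X \in C -> Y \in C -> X != Y -> #|X :&: Y| = 4%N.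
Proof.
move=> cC CX CY nXY; have /andP[/subsetP sC _] := cC.
have := symdiff_clique cC CX CY nXY; have := card_symdiff X Y.
by move: (sC X CX) (sC Y CY); rewrite !inE => /eqP-> /eqP-> + /eqP; card_lia.
Qed.

(** * Seven 4-subsets of a 7-set meeting pairwise in 2 points *)

(** The Cauchy-Schwarz inequality against the constant family 1. *)
Lemma sum_square_bound (I : finType) (R : {pred I}) (r : I -> nat) :
  ((\sum_(x in R) r x) ^ 2 <= #|R| * \sum_(x in R) r x ^ 2)%N.
Proof.
rewrite -(leq_pmul2l (isT : 0 < 2)%N) -mulnn big_distrlr /= big_distrr /=.
have -> : (2 * (#|R| * \sum_(x in R) r x ^ 2) =
           \sum_(x in R) \sum_(y in R) (r x ^ 2 + r y ^ 2))%N.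
  symmetry.
  under eq_bigr do rewrite big_split /= sum_nat_const.
  by rewrite big_split /= sum_nat_const -big_distrr /= mul2n addnn.
apply: leq_sum => x _; rewrite big_distrr /=; apply: leq_sum => y _.
exact: nat_Cauchy.
Qed.

(** A Fisher-type bound by double counting: if [n] is the number of sets and
    [r x] the number of them through [x], then the sum of the [r x] is [4 * n]
    and that of their squares is [n * (4 + 2 * (n - 1))], so Cauchy-Schwarz
    gives [16 * n ^ 2 <= 7 * n * (2 * n + 2)], that is [n <= 7]. *)
Lemma constant_intersection_bound (T : finType) (R : {set T})
    (F : {set {set T}}) :
  #|R| = 7%N ->
  {in F, forall A : {set T}, (A \subset R) /\ #|A| = 4%N} ->
  {in F &, forall A B : {set T}, A != B -> #|A :&: B| = 2%N} ->
  (#|F| <= 7)%N.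
Proof.
move=> cR F4 F2; pose r x := (\sum_(A in F) (x \in A : nat))%N.
have sum_in (A : {set T}) : A \subset R -> (\sum_(x in R) (x \in A : nat) = #|A|)%N.
  move=> sAR; rewrite -[RHS]sum1_card big_mkcond [RHS]big_mkcond /=.
  apply: eq_bigr => x _; case: ifP => [_|/negbT nRx]; first by case: (x \in A).
  by case: ifP => // /(subsetP sAR); rewrite (negPf nRx).
have r1 : (\sum_(x in R) r x = 4 * #|F|)%N.
  rewrite exchange_big /= mulnC -sum_nat_const.
  by apply: eq_bigr => A FA; have [sAR cA] := F4 A FA; rewrite sum_in.
have r2 : (\sum_(x in R) r x ^ 2 = #|F| * (4 + 2 * #|F|.-1))%N.
  transitivity (\sum_(A in F) \sum_(B in F) #|A :&: B|)%N.
    under eq_bigr do rewrite -mulnn big_distrlr /=.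
    rewrite exchange_big /=; apply: eq_bigr => A FA.
    have [sAR _] := F4 A FA.
    rewrite exchange_big /=; apply: eq_bigr => B _.
    rewrite -sum_in; last by rewrite subIset ?sAR.
    by apply: eq_bigr => x _; rewrite inE mulnb.
  rewrite -sum_nat_const; apply: eq_bigr => A FA.
  have [_ cA] := F4 A FA.
  rewrite (bigD1 A) //= setIid cA; congr (_ + _)%N.
  under eq_bigr => B /andP[FB nBA] do rewrite (F2 A B FA FB) 1?eq_sym //.
  rewrite sum_nat_const mulnC; congr (_ * _)%N.
  by rewrite (cardsD1 A F) FA; apply: eq_card => B; rewrite !inE andbC.
have := sum_square_bound (mem R) r; rewrite r1 r2 cR.
by case: #|F| => [|n] //=; nia.
Qed.

(** The space F_2^3, with [bool] as the field F_2. *)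
Definition vec := (bool * bool * bool)%type.

Lemma vec_addrr (p : vec) : p + p = 0.
Proof. by move: p => [[[] []] []]. Qed.

Lemma vec_addKr (p q : vec) : p + (p + q) = q.
Proof. by rewrite addrA vec_addrr add0r. Qed.

Lemma vec_addr_eq0 (p q : vec) : (p + q == 0) = (p == q).
Proof. by rewrite -(inj_eq (addIr q)) -addrA vec_addrr addr0 add0r. Qed.

Lemma card_vec : #|{: vec}| = 8%N.
Proof. by rewrite !card_prod card_bool. Qed.

Notation nonzero V := [set p : V | p != 0].

Lemma card_nonzero_vec : #|nonzero vec| = 7%N.
Proof. by rewrite cardsE (cardC1 (0 : vec)) card_vec. Qed.

(** The complements in [R] of the sets in [F] are the lines of a Fano plane. *)
Definition equidistant_code (R : {set 'I_15}) (F : {set {set 'I_15}}) :=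
  [/\ #|R| = 7%N, #|F| = 7%N,
      {in F, forall A : {set 'I_15}, (A \subset R) /\ #|A| = 4%N}
    & {in F &, forall A B : {set 'I_15}, A != B -> #|A :&: B| = 2%N}].

(** Otherwise [symdiff A B] could be added to the family, against
    [constant_intersection_bound]. Indeed, for a further [X] in the family the
    three sets have [t] common elements with [t <= 2], and [symdiff A B] meets
    [X] in [4 - 2 * t] elements; [t = 2] is impossible because two disjoint
    4-sets do not fit in a 7-set, and [t = 0] means [X = symdiff A B]. *)
Lemma code_symdiff R F A B :
  equidistant_code R F -> A \in F -> B \in F -> A != B ->
  symdiff A B \in F.
Proof.
case=> cR cF F4 F2 FA FB nAB; apply/negPn/negP => nFD.
have [[sAR cA] [sBR cB]] := (F4 A FA, F4 B FB).
set D := symdiff A B in nFD *.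
have sDR : D \subset R.
  by apply/subsetP => x; rewrite !inE => /orP[] /andP[_];
    [apply: (subsetP sAR) | apply: (subsetP sBR)].
have cD : #|D| = 4%N.
  by have := card_symdiff A B; rewrite (F2 A B) // cA cB -/D; card_lia.
have D2 X : X \in F -> #|D :&: X| = 2%N.
  move=> FX; have [sXR cX] := F4 X FX.
  have := card_symdiff (A :&: X) (B :&: X).
  have -> : symdiff (A :&: X) (B :&: X) = D :&: X.
    apply/setP => x; rewrite in_symdiff !in_setI in_symdiff.
    by case: (x \in X); rewrite ?andbT ?andbF.
  rewrite setIACA setIid.
  have [->|nXA] := eqVneq X A.
    by rewrite setIid cA setIAC setIid [B :&: A]setIC (F2 A B) //; card_lia.
  have [->|nXB] := eqVneq X B.
    by rewrite setIid cB -setIA setIid (F2 A B) //; card_lia.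
  rewrite (F2 A X) 1?eq_sym // (F2 B X) 1?eq_sym //.
  have t2 : (#|A :&: B :&: X| <= 2)%N.
    by have := subset_leq_card (subsetIl (A :&: B) X); rewrite (F2 A B).
  have tU : (#|D :|: X| <= 7)%N by rewrite -[leqRHS]cR subset_leq_card // subUset sDR.
  have tI : #|D :&: X| != 4%N.
    apply: contra nFD => /eqP cI.
    have eD : D :&: X = D by apply/eqP; rewrite eqEcard subsetIl cD cI.
    have eX : D :&: X = X by apply/eqP; rewrite eqEcard subsetIr cX cI.
    by rewrite -eD eX.
  by move: (cardsUI D X) t2 tU tI; rewrite cD cX; card_lia.
suff : (#|D |: F| <= 7)%N by rewrite cardsU1 nFD cF.
apply: (constant_intersection_bound cR) => [X|X Y].
  by case/setU1P=> [->|/F4].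
case/setU1P=> [->|FX] /setU1P[->|FY]; rewrite ?eqxx // => nXY.
- exact: D2.
- by rewrite setIC D2.
- exact: F2.
Qed.

Definition span3 (A1 A2 A3 : {set 'I_15}) (p : vec) : {set 'I_15} :=
  let: (x, y, z) := p in
  symdiff (symdiff (if x then A1 else set0) (if y then A2 else set0))
          (if z then A3 else set0).

Lemma in_span3 A1 A2 A3 x y z i :
  (i \in span3 A1 A2 A3 (x, y, z)) =
  (x && (i \in A1)) (+) (y && (i \in A2)) (+) (z && (i \in A3)).
Proof.
by rewrite /span3 !in_symdiff; case: x; case: y; case: z; rewrite ?inE.
Qed.

(** The additive maps from F_2^3 to the F_2-vector space of subsets. *)
Definition xor_morph (a : vec -> {set 'I_15}) :=
  {morph a : p q / p + q >-> symdiff p q}.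

Lemma span3_morph A1 A2 A3 : xor_morph (span3 A1 A2 A3).
Proof.
move=> [[x y] z] [[x' y'] z']; apply/setP => i.
rewrite in_symdiff !in_span3.
by case: x; case: y; case: z; case: x'; case: y'; case: z';
   case: (i \in A1); case: (i \in A2); case: (i \in A3).
Qed.

Section XorMorph.
Variables (a : vec -> {set 'I_15}) (aD : xor_morph a).

Lemma xor_morph0 : a 0 = set0.
Proof. by rewrite -(vec_addrr 0) aD symdiffXX. Qed.

Lemma xor_morph_inj : (forall p, p != 0 -> a p != set0) -> injective a.
Proof.
move=> a0 p q e; apply/eqP; rewrite -vec_addr_eq0; apply/negPn/negP => /a0.
by rewrite aD e symdiffXX eqxx.
Qed.
End XorMorph.

(** Three sets of the family, none of which is the symmetric difference of the
    two others, generate 7 nonempty sets of the family, hence all of it. *)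
Lemma simplex_code R F :
  equidistant_code R F ->
  exists2 a : vec -> {set 'I_15}, xor_morph a & F = a @: nonzero vec.
Proof.
move=> codeF; have [cR cF F4 _] := codeF.
have FD A B : A \in F -> B \in F -> A != B -> symdiff A B \in F.
  exact: code_symdiff codeF.
have pick (G : {set {set 'I_15}}) : (#|G| < 7)%N -> exists2 A, A \in F & A \notin G.
  move=> cG; apply/subsetPn; apply: contraL cG => /subset_leq_card.
  by rewrite cF -leqNgt.
have [|A1 F1 _] := pick set0; first by rewrite cards0.
have [|A2 F2] := pick [set A1]; first by rewrite cards1.
rewrite inE eq_sym => n12; have F12 := FD A1 A2 F1 F2 n12.
have [A3 F3] : exists2 A, A \in F & A \notin [set A1; A2; symdiff A1 A2].
  by apply: pick; rewrite setUC cardsU1 cards2; case: (_ \notin _); case: (_ != _).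
rewrite !inE !negb_or -andbA => /and3P[n31 n32 n312].
have F13 : symdiff A1 A3 \in F by rewrite FD // eq_sym.
have F23 : symdiff A2 A3 \in F by rewrite FD // eq_sym.
have F123 : symdiff (symdiff A1 A2) A3 \in F by rewrite FD // eq_sym.
exists (span3 A1 A2 A3); first exact: span3_morph.
have aF p : p != 0 -> span3 A1 A2 A3 p \in F.
  by move: p => [[[] []] []] //= _;
    rewrite ?symdiff0 // ![symdiff set0 _]symdiffC ?symdiff0.
apply/esym/eqP; rewrite eqEcard; apply/andP; split.
  by apply/subsetP => _ /imsetP[p + ->]; rewrite inE => /aF.
rewrite card_imset ?card_nonzero_vec ?cF //.
apply: xor_morph_inj => [|p /aF/F4[_]]; first exact: span3_morph.
by apply: contra_eq_neq => ->; rewrite cards0.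
Qed.

(** * Bijections of F_2^3 up to linear changes of coordinates *)

Definition pick_if (x : bool) (u : vec) : vec := if x then u else 0.

Lemma pick_ifD x y u : pick_if (x (+) y) u = pick_if x u + pick_if y u.
Proof. by case: x; case: y; rewrite /= ?vec_addrr ?addr0 ?add0r. Qed.

Definition lin (u v t p : vec) : vec :=
  pick_if p.1.1 u + pick_if p.1.2 v + pick_if p.2 t.

Lemma lin_morph u v t : {morph lin u v t : p q / p + q}.
Proof.
move=> [[x y] z] [[x' y'] z'].
have -> : (x, y, z) + (x', y', z') = (x (+) x', y (+) y', z (+) z') by [].
by rewrite /lin /= !pick_ifD [RHS]addrACA; congr (_ + _); rewrite addrACA.
Qed.

Lemma vec_morph0 (g : vec -> vec) : {morph g : p q / p + q} -> g 0 = 0.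
Proof. by move=> gD; rewrite -[RHS](vec_addrr (g 0)) -gD vec_addrr. Qed.

Lemma vec_morph_inj (g : vec -> vec) :
  {morph g : p q / p + q} -> (forall p, g p = 0 -> p = 0) -> injective g.
Proof.
move=> gD g0 p q e; apply/eqP; rewrite -vec_addr_eq0; apply/eqP/g0.
by rewrite gD e vec_addrr.
Qed.

Lemma lin_inj u v t :
  u != 0 -> v != 0 -> u != v -> t != 0 -> t != u -> t != v -> t != u + v ->
  injective (lin u v t).
Proof.
move=> u0 v0 uv t0 tu tv tuv; apply: vec_morph_inj; first exact: lin_morph.
move=> [[[] []] []] //; rewrite /lin /= ?addr0 ?add0r => /eqP;
  by rewrite ?vec_addr_eq0 ?[_ == t]eq_sym ?(negPf u0) ?(negPf v0) ?(negPf t0)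
     ?(negPf uv) ?(negPf tu) ?(negPf tv) ?(negPf tuv).
Qed.

(** The four double cosets of GL(3,2) in the symmetric group on the nonzero
    vectors of F_2^3. The names tell on which lines of the Fano plane the
    bijection is additive: all of them, the three lines of a pencil, a single
    line, or no line. *)
Variant kind := Linear | Pencil | Single | Free.

(** The permutation of the three nonzero vectors of F_2^2 attached to a
    nonlinear bijection: the identity, a transposition, a 3-cycle. *)
Definition turn (k : kind) (w : bool * bool) : bool * bool :=
  match k with
  | Linear | Pencil => w
  | Single => (w.2, w.1)
  | Free => (w.2, w.1 (+) w.2)
  end.

(** Sends the nonzero vectors [(1, 0)], [(0, 1)], [(1, 1)], whose sum is 0, to
    the standard basis of F_2^3. *)
Definition bend (w : bool * bool) : vec :=
  (w.1 && ~~ w.2, ~~ w.1 && w.2, w.1 && w.2).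

Definition twist (k : kind) (p : vec) : vec :=
  if k is Linear then p else
  if p.2 then (true, true, true) + bend (turn k p.1) else bend p.1.

Definition twisted (phi : vec -> vec) (k : kind) :=
  exists g h : vec -> vec,
    [/\ {morph g : p q / p + q}, injective g, {morph h : p q / p + q},
        injective h & forall p, phi (g p) = h (twist k p)].

Definition comb (u v : vec) (w : bool * bool) : vec :=
  pick_if w.1 u + pick_if w.2 v.

Lemma comb_morph u v : {morph comb u v : w w' / w + w'}.
Proof.
move=> [x y] [x' y']; have -> : (x, y) + (x', y') = (x (+) x', y (+) y') by [].
by rewrite /comb /= !pick_ifD addrACA.
Qed.

Section Bent.
Variables (phi : vec -> vec) (phi_inj : injective phi) (phi0 : phi 0 = 0).
Variables (u v : vec) (phiD : phi (u + v) != phi u + phi v).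

Let h := lin (phi u) (phi v) (phi (u + v)).

Lemma bent_independent : [/\ u != 0, v != 0 & u != v].
Proof.
split.
- by apply: contraNneq phiD => ->; rewrite phi0 !add0r.
- by apply: contraNneq phiD => ->; rewrite phi0 !addr0.
- by apply: contraNneq phiD => ->; rewrite !vec_addrr phi0.
Qed.

Lemma comb_inj : injective (comb u v).
Proof.
have [u0 v0 uv] := bent_independent.
move=> [x y] [x' y'] e; apply/eqP.
have : comb u v ((x, y) + (x', y')) == 0 by rewrite comb_morph e vec_addrr.
by case: x {e}; case: y; case: x'; case: y';
  rewrite // /comb /= ?addr0 ?add0r ?vec_addr_eq0 ?(negPf u0) ?(negPf v0) ?(negPf uv).
Qed.

Lemma bent_image_inj : injective h.
Proof.
have [u0 v0 uv] := bent_independent.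
have phi_eq0 p : (phi p == 0) = (p == 0) by rewrite -{1}phi0 (inj_eq phi_inj).
have uvu : u + v != u by rewrite -subr_eq0 addrC addrA addNr add0r.
have uvv : u + v != v by rewrite -subr_eq0 addrK.
by apply: lin_inj; rewrite ?phi_eq0 ?(inj_eq phi_inj) ?vec_addr_eq0.
Qed.

(** The values of [phi] on the plane of [u] and [v] are 0 and the basis [phi u],
    [phi v], [phi (u + v)]: this is what [bend] describes. *)
Lemma phi_comb w : phi (comb u v w) = h (bend w).
Proof. by case: w => [[] []]; rewrite /comb /h /lin /= ?addr0 ?add0r. Qed.

Variables (t : vec) (phit : phi t = phi u + phi v + phi (u + v)).

Lemma apex_notin_span w : t != comb u v w.
Proof.
have e : phi t = h (true, true, true) by [].
rewrite -(inj_eq phi_inj) e phi_comb (inj_eq bent_image_inj).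
by case: w => [[] []].
Qed.

Lemma bent_twisted k :
  k <> Linear ->
  (forall w, phi (comb u v w + t) = phi t + phi (comb u v (turn k w))) ->
  twisted phi k.
Proof.
have [u0 v0 uv] := bent_independent.
move=> nk phitw; exists (lin u v t), h; split => //.
- exact: lin_morph.
- apply: lin_inj => //.
  + by have := apex_notin_span (false, false); rewrite /comb /= addr0.
  + by have := apex_notin_span (true, false); rewrite /comb /= addr0.
  + by have := apex_notin_span (false, true); rewrite /comb /= add0r.
  + exact: (apex_notin_span (true, true)).
- exact: lin_morph.
- exact: bent_image_inj.
move=> [w z]; rewrite /twist.
have -> : lin u v t (w, z) = comb u v w + pick_if z t by [].
case: k nk phitw => [[] //|||] _ phitw; case: z => /=; rewrite ?addr0 ?phi_comb //.
all: by rewrite phitw phi_comb /h lin_morph phit.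
Qed.

(** Every vector is [bend w'] or [(1, 1, 1) + bend w']. The values of the first
    form are taken on the plane of [u] and [v], and [phi t] is the value of the
    second form with [w' = 0]; the other translates of [t] get what is left. *)
Lemma phi_apex_translate w :
  w != 0 -> exists2 w', w' != 0 & phi (comb u v w + t) = phi t + phi (comb u v w').
Proof.
move=> w0; have [h' hK h'K] := injF_bij bent_image_inj.
have split_vec (c : vec) : exists w', c = bend w' \/ c = (true, true, true) + bend w'.
  move: c => [[[] []] []].
  - by exists (false, false); right.
  - by exists (true, true); right.
  - by exists (false, true); right.
  - by exists (true, false); left.
  - by exists (true, false); right.
  - by exists (false, true); left.
  - by exists (true, true); left.
  - by exists (false, false); left.
have [w' e] := split_vec (h' (phi (comb u v w + t))).
case: e => /(congr1 h); rewrite h'K => e.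
  move: e; rewrite -phi_comb => /phi_inj e.
  by have := apex_notin_span (w + w'); rewrite comb_morph -e vec_addKr eqxx.
exists w'; last by rewrite phi_comb e /h lin_morph phit.
apply: contraNneq w0 => w'0; apply/eqP/comb_inj.
move: e; rewrite w'0 addr0 => e.
have /phi_inj e' : phi (comb u v w + t) = phi t by rewrite e phit.
by rewrite -[comb u v w]addr0 -(vec_addrr t) addrA e' vec_addrr.
Qed.
End Bent.

(** Of the six permutations of [u], [v], [u + v] induced by [phi], the identity,
    one transposition and one 3-cycle have the form given by [turn] with respect
    to [u] and [v]; for the others, [u + v] takes the place of [u] or [v]. *)
Lemma twist_normal_form phi :
  injective phi -> phi 0 = 0 -> exists k, twisted phi k.
Proof.
move=> phi_inj phi0.
have [/forallP phiD|] :=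
    boolP [forall p : vec, forall q : vec, phi (p + q) == phi p + phi q].
  exists Linear, id, phi; split=> // p q; exact/eqP/(forallP (phiD p)).
rewrite negb_forall => /existsP[u]; rewrite negb_forall => /existsP[v phiD].
have [phi' phiK phi'K] := injF_bij phi_inj.
have [t phit] : exists t, phi t = phi u + phi v + phi (u + v).
  by exists (phi' (phi u + phi v + phi (u + v))).
have tr := phi_apex_translate phi_inj phi0 phiD phit.
have [w1 n1] := tr (true, false) isT; have [w2 n2] := tr (false, true) isT.
have [w3 n3] := tr (true, true) isT; rewrite /comb /= ?addr0 ?add0r => e3 e2 e1.
have uv : u != v by have [] := bent_independent phi0 phiD.
have u0 : u != 0 by have [] := bent_independent phi0 phiD.
have v0 : v != 0 by have [] := bent_independent phi0 phiD.
have ne (p q : vec) : p != q -> phi (p + t) != phi (q + t).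
  by rewrite (inj_eq phi_inj) (inj_eq (addIr t)).
have n12 := ne _ _ uv.
have n13 : phi (u + t) != phi (u + v + t).
  by apply: ne; rewrite -[u in u != _]addr0 (inj_eq (addrI u)) eq_sym.
have n23 : phi (v + t) != phi (u + v + t).
  by apply: ne; rewrite -[v in v != _]add0r (inj_eq (addIr v)) eq_sym.
have uuv : u + (u + v) = v by exact: vec_addKr.
have vuv : v + (u + v) = u by rewrite [u + v]addrC vec_addKr.
have Duw : phi (u + (u + v)) != phi u + phi (u + v).
  by rewrite uuv; apply: contraNneq phiD => ->; rewrite vec_addKr.
have tuw : phi t = phi u + phi (u + v) + phi (u + (u + v)).
  by rewrite uuv phit addrAC.
have Dvw : phi (v + (u + v)) != phi v + phi (u + v).
  by rewrite vuv; apply: contraNneq phiD => ->; rewrite addrAC vec_addrr add0r.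
have tvw : phi t = phi v + phi (u + v) + phi (v + (u + v)).
  by rewrite vuv phit -addrA addrC.
move: n12 n13 n23; rewrite e1 e2 e3.
case: w1 w2 w3 n1 n2 n3 e1 e2 e3 => [[] []] [[] []] [[] []] //= _ _ _;
  rewrite /pick_if ?addr0 ?add0r ?eqxx // => e1 e2 e3 _ _ _.
- exists Free; apply: (bent_twisted phi_inj phi0 Duw tuw) => // -[[] []];
    by rewrite /comb /= ?addr0 ?add0r ?uuv ?phi0 ?addr0.
- exists Single; apply: (bent_twisted phi_inj phi0 Duw tuw) => // -[[] []];
    by rewrite /comb /= ?addr0 ?add0r ?uuv ?phi0 ?addr0.
- exists Single; apply: (bent_twisted phi_inj phi0 Dvw tvw) => // -[[] []];
    by rewrite /comb /= ?addr0 ?add0r ?vuv ?phi0 ?addr0.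
- exists Pencil; apply: (bent_twisted phi_inj phi0 phiD phit) => // -[[] []];
    by rewrite /comb /= ?addr0 ?add0r ?phi0 ?addr0.
- exists Free; apply: (bent_twisted phi_inj phi0 phiD phit) => // -[[] []];
    by rewrite /comb /= ?addr0 ?add0r ?phi0 ?addr0.
- exists Single; apply: (bent_twisted phi_inj phi0 phiD phit) => // -[[] []];
    by rewrite /comb /= ?addr0 ?add0r ?phi0 ?addr0.
Qed.

(** * Coordinates *)

Definition dot (p c : vec) : bool :=
  (p.1.1 && c.1.1) (+) (p.1.2 && c.1.2) (+) (p.2 && c.2).

Definition coords (a : vec -> {set 'I_15}) (i : 'I_15) : vec :=
  (i \in a (true, false, false), i \in a (false, true, false),
   i \in a (false, false, true)).

Lemma in_xor_morph a p i : xor_morph a -> (i \in a p) = dot p (coords a i).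
Proof.
move=> aD; have D q r : (i \in a (q + r)) = (i \in a q) (+) (i \in a r).
  by rewrite aD in_symdiff.
move: p => [[x y] z].
have -> : (x, y, z) = (x, false, false) + (false, y, false) + (false, false, z).
  by case: x; case: y; case: z.
have z0 : i \in a (false, false, false) = false.
  by rewrite -[(false, false, false)]/(0 : vec) xor_morph0 // inE.
by rewrite !D /dot /coords; case: x; case: y; case: z; rewrite /= ?z0 ?addbF.
Qed.

(** Makes sums over F_2^3 accessible to linear arithmetic. *)
Lemma big_vec (F : vec -> nat) :
  (\sum_c F c =
   F (true, true, true) + F (true, true, false) + F (true, false, true) +
   F (true, false, false) + F (false, true, true) + F (false, true, false) +
   F (false, false, true) + F (false, false, false))%N.
Proof.
transitivity (\sum_(p : bool * bool) \sum_(z : bool) F (p, z))%N.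
  by rewrite pair_bigA; apply: eq_bigr => -[].
under eq_bigr do rewrite big_bool.
transitivity (\sum_(x : bool) \sum_(y : bool) (F (x, y, true) + F (x, y, false)))%N.
  by rewrite pair_bigA; apply: eq_bigr => -[].
by rewrite big_bool !big_bool /= !addnA.
Qed.

(** The numbers [n c] of elements of [R] with coordinate vector [c] satisfy
    eight linear equations: they sum to 7, and each of the seven sets [a p] has
    4 elements. This system is regular, and its solution is [n 0 = 0] and [n c = 1] for [c != 0]. *)
Lemma coords_separate (R : {set 'I_15}) (a : vec -> {set 'I_15}) :
  xor_morph a -> #|R| = 7%N ->
  (forall p, p != 0 -> (a p \subset R) /\ #|a p| = 4%N) ->
  {in R, forall i, coords a i != 0} /\ {in R &, injective (coords a)}.
Proof.
move=> aD cR a4; pose n c := #|[set i in R | coords a i == c]|.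
have sum_n (P : pred vec) :
    (#|[set i in R | P (coords a i)]| = \sum_c P c * n c)%N.
  rewrite -sum1_card (partition_big (coords a) predT) //=.
  apply: eq_bigr => c _; case Pc : (P c); rewrite ?mul1n ?mul0n; last first.
    by rewrite big1 // => i; rewrite inE => /andP[/andP[_ +] /eqP e]; rewrite e Pc.
  rewrite /n -sum1_card; apply: eq_bigl => i; rewrite !inE.
  by case: eqP => [->|]; rewrite ?Pc ?andbT ?andbF.
have n4 p : p != 0 -> (\sum_c dot p c * n c = 4)%N.
  move=> /a4[sR <-]; rewrite -sum_n; apply: eq_card => i.
  rewrite inE -in_xor_morph //; case ai : (i \in a p); rewrite ?andbF ?andbT //.
  exact: (subsetP sR).
have n7 : (\sum_c n c = 7)%N.
  rewrite -cR -[RHS](_ : #|[set i in R | predT (coords a i)]| = _).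
    by rewrite sum_n; apply: eq_bigr => c _; rewrite mul1n.
  by apply: eq_card => i; rewrite inE andbT.
have n1 c : n c = (c != 0).
  move: n7 (n4 (true, false, false) isT) (n4 (false, true, false) isT)
    (n4 (true, true, false) isT) (n4 (false, false, true) isT)
    (n4 (true, false, true) isT) (n4 (false, true, true) isT)
    (n4 (true, true, true) isT).
  rewrite !big_vec /dot /= !mul1n !mul0n.
  by case: c => [[[] []] []] /=; lia.
split=> [i Ri|i j Ri Rj eij].
  have : (0 < n (coords a i))%N by apply/card_gt0P; exists i; rewrite inE Ri /=.
  by rewrite n1; case: (_ != _).
apply/eqP/negPn/negP => nij.
have : (#|[set i; j]| <= n (coords a i))%N.
  apply: subset_leq_card; apply/subsetP => x.
  by rewrite !inE => /orP[]/eqP->; rewrite ?Ri ?Rj ?eij eqxx.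
by rewrite n1 cards2 nij; case: (_ != _).
Qed.

(** The coordinate map [kappa] attaches to an element of the 15-set a pair whose
    first component says whether it lies in the center [O]. The vector [p.1]
    gives the traces inside and outside [O], and [p.2] complements the former. *)
Definition pt (kappa : 'I_15 -> bool * vec) (k : kind) (p : vec * bool) :
    {set 'I_15} :=
  [set i | if (kappa i).1 then dot p.1 (kappa i).2 (+) p.2
           else dot (twist k p.1) (kappa i).2].

Definition normal_form (kappa : 'I_15 -> bool * vec) (k : kind)
    (C : {set {set 'I_15}}) :=
  [/\ injective kappa, forall i, kappa i != (false, 0)
    & C = pt kappa k @: nonzero (vec * bool)].

(** * Every centered clique has a normal form *)

Lemma code_imset (R : {set 'I_15}) (H : {set {set 'I_15}})
    (f : {set 'I_15} -> {set 'I_15}) :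
  #|R| = 7%N -> #|H| = 7%N ->
  (forall X, X \in H -> (f X \subset R) /\ #|f X| = 4%N) ->
  {in H &, forall X Y, X != Y -> #|f X :&: f Y| = 2%N} ->
  {in H &, injective f} /\ equidistant_code R (f @: H).
Proof.
move=> cR cH f4 f2; have f_inj : {in H &, injective f}.
  move=> X Y HX HY e; apply/eqP/negPn/negP => nXY.
  by have := f2 X Y HX HY nXY; rewrite e setIid (f4 Y HY).2.
split=> //; split=> //; first by rewrite card_in_imset.
  by move=> _ /imsetP[X HX ->]; apply: f4.
move=> _ _ /imsetP[X HX ->] /imsetP[Y HY ->] nf; apply: f2 => //.
by apply: contraNneq nf => ->.
Qed.

Section Centered.
Variables (C : {set {set 'I_15}}) (O : {set 'I_15}).
Hypotheses (cC : clique C) (card_C : #|C| = 15%N) (cO : center_point C O).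

Let CO : O \in C. Proof. by case/andP: cO. Qed.

Let card8 X : X \in C -> #|X| = 8%N.
Proof.
by move=> CX; have /andP[/subsetP/(_ X CX) + _] := cC; rewrite inE => /eqP.
Qed.

Lemma center_symdiff X : X \in C -> X != O -> symdiff X O \in C.
Proof.
move=> CX nXO; have /andP[_ /forall_inP/(_ X)] := cO.
by rewrite !inE nXO => /(_ CX)/subsetP; apply; rewrite !inE eqxx !orbT.
Qed.

Lemma center_symdiff_neq X : X \in C -> symdiff X O != O.
Proof.
move=> CX; apply: contra_eq_neq (card8 CX) => e.
by rewrite -[X](symdiffKr X O) e symdiffXX cards0.
Qed.

Lemma card_trace X : X \in C -> X != O -> #|X :&: O| = 4%N /\ #|X :\: O| = 4%N.
Proof.
move=> CX nXO; have c4 := clique_cardI cC CX CO nXO.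
by split=> //; move: (cardsID O X); rewrite c4 (card8 CX); card_lia.
Qed.

(** [X] meets both [Y] and [symdiff Y O] in 4 elements. These two sets agree
    outside [O] and are complementary inside [O], where [X] has 4 elements. *)
Lemma card_trace2 X Y :
  X \in C -> Y \in C -> X != O -> Y != O -> X != Y -> X != symdiff Y O ->
  #|(X :&: O) :&: (Y :&: O)| = 2%N /\ #|(X :\: O) :&: (Y :\: O)| = 2%N.
Proof.
move=> CX CY nXO nYO nXY nXY'.
have c1 := clique_cardI cC CX CY nXY.
have c2 := clique_cardI cC CX (center_symdiff CY nYO) nXY'.
have [c3 _] := card_trace CX nXO.
have e1 : (X :&: Y) :&: O = (X :&: O) :&: (Y :&: O) by rewrite setIACA setIid.
have e2 : (X :&: Y) :\: O = (X :\: O) :&: (Y :\: O).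
  by apply/setP => i; rewrite !inE; case: (i \in O); rewrite ?andbF.
have e3 : (X :&: symdiff Y O) :&: O = (X :&: O) :\: (Y :&: O).
  apply/setP => i; rewrite !(in_symdiff, in_setI, in_setD).
  by case: (i \in O); case: (i \in X); case: (i \in Y).
have e4 : (X :&: symdiff Y O) :\: O = (X :\: O) :&: (Y :\: O).
  apply/setP => i; rewrite !(in_symdiff, in_setI, in_setD).
  by case: (i \in O); case: (i \in X); case: (i \in Y).
move: (cardsID O (X :&: Y)) (cardsID O (X :&: symdiff Y O)).
move: (cardsID (Y :&: O) (X :&: O)); rewrite e1 e2 e3 e4 c1 c2 c3; card_lia.
Qed.

Variables (x0 : 'I_15) (Ox0 : x0 \in O).

Let H := [set X in C :\ O | x0 \notin X].

Let HP X : X \in H -> [/\ X \in C, X != O & x0 \notin X].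
Proof. by rewrite !inE => /andP[/andP[]]. Qed.

(** Taking the symmetric difference with [O] exchanges the points of [C :\ O]
    that contain [x0] with those that do not. *)
Lemma card_half : #|H| = 7%N.
Proof.
have eC : #|C :\ O| = 14%N by have := cardsD1 O C; rewrite CO card_C => -[].
have := cardsID [set X : {set 'I_15} | x0 \notin X] (C :\ O); rewrite eC.
have -> : (C :\ O) :&: [set X : {set 'I_15} | x0 \notin X] = H.
  by apply/setP => X; rewrite !inE.
suff -> : (C :\ O) :\: [set X : {set 'I_15} | x0 \notin X] = symdiff O @: H.
  rewrite card_imset; first by rewrite addnn => /(congr1 half); rewrite doubleK.
  by apply: (can_inj (g := symdiff O)) => X; rewrite symdiffK.
apply/setP => X; apply/idP/imsetP => [|[Y /HP[CY nYO Yx0] ->]].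
  rewrite !inE negbK => /and3P[Xx0 nXO CX]; exists (symdiff O X); last first.
    by rewrite symdiffK.
  rewrite in_set in_setD1 in_symdiff Ox0 Xx0 symdiffC center_symdiff // !andbT.
  exact: center_symdiff_neq.
rewrite in_setD in_set in_setD1 in_symdiff Ox0 (negPf Yx0) /=.
rewrite symdiffC center_symdiff // !andbT.
exact: center_symdiff_neq.
Qed.

Lemma half_traces X Y :
  X \in H -> Y \in H -> X != Y ->
  #|(X :&: O) :&: (Y :&: O)| = 2%N /\ #|(X :\: O) :&: (Y :\: O)| = 2%N.
Proof.
move=> /HP[CX nXO Xx0] /HP[CY nYO Yx0] nXY; apply: card_trace2 => //.
by apply: contraNneq Xx0 => ->; rewrite in_symdiff Ox0 (negPf Yx0).
Qed.

Lemma inner_code :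
  {in H &, injective (fun X => X :&: O)} /\
  equidistant_code (O :\ x0) [set X :&: O | X in H].
Proof.
apply: code_imset => [||X|X Y HX HY nXY].
- by have := cardsD1 x0 O; rewrite Ox0 (card8 CO) => -[].
- exact: card_half.
- move=> /HP[CX nXO Xx0]; split; last by have [] := card_trace CX nXO.
  apply/subsetP => i; rewrite !inE => /andP[Xi ->]; rewrite andbT.
  by apply: contraNneq Xx0 => <-.
- by have [] := half_traces HX HY nXY.
Qed.

Lemma outer_code :
  {in H &, injective (fun X => X :\: O)} /\
  equidistant_code (~: O) [set X :\: O | X in H].
Proof.
apply: code_imset => [||X|X Y HX HY nXY].
- by have := cardsC O; rewrite card_ord (card8 CO); card_lia.
- exact: card_half.
- move=> /HP[CX nXO Xx0]; split; last by have [] := card_trace CX nXO.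
  by apply/subsetP => i; rewrite !inE => /andP[].
- by have [] := half_traces HX HY nXY.
Qed.
(** The bijection [phi] matches the two codes of traces. Replacing their
    parametrizations [a] and [b] by [a \o g] and [b \o h] brings [phi] into one
    of the four standard forms, and the elements of [O] and of its complement
    get as coordinates the linear forms that they induce on the codes. *)
Lemma normal_form_exists_at : exists kappa k, normal_form kappa k C.
Proof.
have [in_inj codeA] := inner_code; have [out_inj codeB] := outer_code.
have [a aD eA] := simplex_code codeA; have [b bD eB] := simplex_code codeB.
have [cA _ A4 _] := codeA; have [cB _ B4 _] := codeB.
have aP p : p != 0 -> (a p \subset O :\ x0) /\ #|a p| = 4%N.
  by move=> p0; apply: A4; rewrite eA imset_f // inE.
have bP p : p != 0 -> (b p \subset ~: O) /\ #|b p| = 4%N.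
  by move=> p0; apply: B4; rewrite eB imset_f // inE.
have a_inj : injective a.
  apply: xor_morph_inj => // p /aP[_].
  by apply: contra_eq_neq => ->; rewrite cards0.
have aO p i : i \in a p -> i \in O :\ x0.
  have [->|/aP[/subsetP + _]] := eqVneq p 0; first by rewrite xor_morph0 // inE.
  exact.
have bO p i : i \in b p -> i \notin O.
  have [->|/bP[/subsetP + _]] := eqVneq p 0; first by rewrite xor_morph0 // inE.
  by move=> /[apply]; rewrite inE.
have /fin_all_exists[phi phiP] : forall p, exists q,
    if p == 0 then q = 0 else q != 0 /\ symdiff (a p) (b q) \in H.
  move=> p; case: eqP => [_|/eqP p0]; first by exists 0.
  have /imsetP[X HX eX] : a p \in [set X :&: O | X in H].
    by rewrite eA imset_f // inE.
  have /imsetP[q q0 eq] : X :\: O \in b @: nonzero vec.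
    by rewrite -eB; exact: (imset_f (fun Y : {set 'I_15} => Y :\: O)).
  exists q; split; first by move: q0; rewrite inE.
  suff -> : symdiff (a p) (b q) = X by [].
  rewrite eX -eq; apply/setP => i; rewrite in_symdiff !inE.
  by case: (i \in O); case: (i \in X).
have phi0 : phi 0 = 0 by exact: (phiP 0).
have phiH p : p != 0 -> phi p != 0 /\ symdiff (a p) (b (phi p)) \in H.
  by move=> p0; have := phiP p; rewrite (negPf p0).
have b_in q i : i \in O -> (i \in b q) = false.
  by move=> Oi; apply/negP => /bO; rewrite Oi.
have a_out p i : i \notin O -> (i \in a p) = false.
  by move=> Oi; apply/negP => /aO; rewrite in_setD1 (negPf Oi) andbF.
have traceA p q : symdiff (a p) (b q) :&: O = a p.
  apply/setP => i; rewrite in_setI in_symdiff.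
  have [Oi|Oi] := boolP (i \in O); first by rewrite b_in // addbF andbT.
  by rewrite a_out // andbF.
have traceB p q : symdiff (a p) (b q) :\: O = b q.
  apply/setP => i; rewrite in_setD in_symdiff.
  by have [Oi|Oi] := boolP (i \in O); [rewrite b_in | rewrite a_out].
have phi_inj : injective phi.
  move=> p q e; have [p0|p0] := eqVneq p 0; have [q0|q0] := eqVneq q 0.
  - by rewrite p0 q0.
  - by have [] := phiH q q0; rewrite -e p0 phi0 eqxx.
  - by have [] := phiH p p0; rewrite e q0 phi0 eqxx.
  have [[_ Hp] [_ Hq]] := (phiH p p0, phiH q q0).
  apply: a_inj; rewrite -(traceA p (phi p)) -(traceA q (phi q)); congr (_ :&: _).
  by apply: out_inj => //; rewrite !traceB e.
have [k [g [h [gD g_inj hD h_inj gh]]]] := twist_normal_form phi_inj phi0.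
pose a' p := a (g p); pose b' p := b (h p).
have a'D : xor_morph a' by move=> p q; rewrite /a' gD aD.
have b'D : xor_morph b' by move=> p q; rewrite /b' hD bD.
have ker0 (f : vec -> vec) : injective f -> {morph f : p q / p + q} ->
    forall p, p != 0 -> f p != 0.
  move=> f_inj fD p; apply: contraNneq => e.
  by apply/eqP/f_inj; rewrite e (vec_morph0 fD).
have [a'0 a'_inj] :=
  coords_separate a'D cA (fun p p0 => aP _ (ker0 _ g_inj gD p p0)).
have [b'0 b'_inj] :=
  coords_separate b'D cB (fun p p0 => bP _ (ker0 _ h_inj hD p p0)).
pose kappa i := (i \in O, if i \in O then coords a' i else coords b' i).
have ptE p e :
    pt kappa k (p, e) =
    symdiff (symdiff (a' p) (b' (twist k p))) (if e then O else set0).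
  apply/setP => i; rewrite in_set /kappa /= !in_symdiff.
  have -> : i \in (if e then O else set0) = e && (i \in O).
    by case: e; rewrite // inE.
  have [Oi|Oi] := boolP (i \in O).
    by rewrite /b' b_in // addbF andbT in_xor_morph.
  by rewrite /a' a_out // andbF addbF in_xor_morph.
exists kappa, k; split.
(* The element [x0] is in no set [a p], so that it takes the coordinate vector 0,
   which the elements of [O :\ x0] leave free. *)
- move=> i j; rewrite /kappa.
  case Oi : (i \in O); case Oj : (j \in O) => /eqP;
    rewrite xpair_eqE //= => /eqP; last by apply: b'_inj; rewrite inE ?Oi ?Oj.
  have x00 : coords a' x0 = 0.
    have nx q : x0 \in a q = false.
      by apply/negP => /aO; rewrite !inE eqxx.
    by rewrite /coords /a' !nx.
  have [->|ni] := eqVneq i x0; have [->|nj] := eqVneq j x0 => //.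
  + by have := a'0 j; rewrite in_setD1 nj Oj => /(_ isT) + e; rewrite -e x00 eqxx.
  + by have := a'0 i; rewrite in_setD1 ni Oi => /(_ isT) + e; rewrite e x00 eqxx.
  + by apply: a'_inj; rewrite in_setD1 ?ni ?nj.
- move=> i; rewrite /kappa; case Oi : (i \in O) => //.
  by rewrite -pair_eqE /= b'0 // inE Oi.
(* Both sides have at most 15 elements, so one inclusion is enough. *)
apply/eqP; rewrite eqEcard card_C (leq_trans (leq_imset_card _ _)) ?andbT;
  last first.
  by rewrite cardsE (cardC1 (0 : vec * bool)) card_prod card_vec card_bool.
have [g' gK g'K] := injF_bij g_inj.
have inH X e : X \in H -> symdiff X (if e then O else set0) \in
    pt kappa k @: nonzero (vec * bool).
  move=> HX; have /imsetP[p p0 ep] : X :&: O \in a @: nonzero vec.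
    by rewrite -eA; exact: (imset_f (fun Y : {set 'I_15} => Y :&: O)).
  move: p0; rewrite inE => p0; have [_ Hp] := phiH p p0.
  have -> : X = symdiff (a p) (b (phi p)).
    by apply: in_inj => //; rewrite traceA.
  apply/imsetP; exists (g' p, e); last by rewrite ptE /a' /b' -gh g'K.
  rewrite inE; apply: contraNneq p0 => -[g'0 _].
  by rewrite -(g'K p) g'0 (vec_morph0 gD).
apply/subsetP => X CX; have [->|nXO] := eqVneq X O.
  apply/imsetP; exists (0, true); first by rewrite inE.
  have t0 : twist k 0 = 0 by case: (k).
  rewrite ptE t0 !xor_morph0 //; apply/setP => i.
  by rewrite !in_symdiff inE.
have [Xx0|Xx0] := boolP (x0 \in X); last first.
  by rewrite -[X]symdiff0; apply: (inH X false); rewrite !inE nXO CX.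
rewrite -[X](symdiffKr X O); apply: (inH _ true).
by rewrite in_set in_setD1 center_symdiff // center_symdiff_neq // in_symdiff Xx0 Ox0.
Qed.
End Centered.

Lemma normal_form_exists C :
  centered_max_clique15 C -> exists kappa k, normal_form kappa k C.
Proof.
case/and3P=> /maxsetP[cC _] /eqP card_C /existsP[O cO].
have CO : O \in C by case/andP: cO.
have /card_gt0P[x0 Ox0] : (0 < #|O|)%N.
  by have /andP[/subsetP/(_ O CO) + _] := cC; rewrite inE => /eqP->.
exact: (normal_form_exists_at cC card_C cO Ox0).
Qed.


(** There are 15 coordinate pairs other than [(false, 0)]. *)
Lemma coordinates_onto (kappa : 'I_15 -> bool * vec) :
  injective kappa -> (forall i, kappa i != (false, 0)) ->
  forall c, c != (false, 0) -> exists i, kappa i = c.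
Proof.
move=> k_inj k0 c c0; have : c \in [set~ (false, 0 : vec)] by rewrite !inE.
suff <- : kappa @: setT = [set~ (false, 0 : vec)].
  by case/imsetP=> i _ ->; exists i.
apply/eqP; rewrite eqEcard card_imset // cardsT card_ord cardsC1.
rewrite card_prod card_vec card_bool andbT.
by apply/subsetP => _ /imsetP[i _ ->]; rewrite !inE.
Qed.

Lemma normal_form_perm kappa kappa' k C C' :
  normal_form kappa k C -> normal_form kappa' k C' ->
  exists s : {perm 'I_15}, perm_image s C = C'.
Proof.
move=> [k_inj k0 ->] [k'_inj k'0 ->].
have /fin_all_exists[f fP] i : exists j, kappa' j = kappa i.
  exact: coordinates_onto.
have f_inj : injective f by move=> i j e; apply: k_inj; rewrite -!fP e.
exists (perm f_inj); rewrite /perm_image -imset_comp; apply: eq_imset => p.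
apply/setP => j; rewrite -[j](permKV (perm f_inj)) mem_imset; last exact: perm_inj.
by rewrite !in_set permE fP.
Qed.

(** * Fano planes *)

Lemma F2_cases (k : 'F_2) : k = 0 \/ k = 1.
Proof. by case: k => [[|[|k]] lt] //; [left | right]; apply/val_inj. Qed.

(** Over F_2 a vector line has a single nonzero vector, which [vpick] returns. *)
Lemma in_line2 (u x : 'rV['F_2]_3) : (x \in <[u]>%VS) = (x == 0) || (x == u).
Proof.
apply/vlineP/orP => [[k ->]|[]/eqP->].
- by case: (F2_cases k) => ->; rewrite ?scale0r ?scale1r ?eqxx; [left | right].
- by exists 0; rewrite scale0r.
- by exists 1; rewrite scale1r.
Qed.

Lemma in_span2 (u v x : 'rV['F_2]_3) :
  (x \in <<[:: u; v]>>%VS) = [|| x == 0, x == u, x == v | x == u + v].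
Proof.
rewrite span_cons span_seq1; apply/memv_addP/idP => [[y + [z + ->]]|].
  rewrite !in_line2 => /orP[]/eqP-> /orP[]/eqP->;
  by rewrite ?addr0 ?add0r eqxx ?orbT.
case/or4P=> /eqP->.
- by exists 0; rewrite ?mem0v //; exists 0; rewrite ?mem0v ?addr0.
- by exists u; rewrite ?memv_line //; exists 0; rewrite ?mem0v ?addr0.
- by exists 0; rewrite ?mem0v //; exists v; rewrite ?memv_line ?add0r.
- by exists u; rewrite ?memv_line //; exists v; rewrite ?memv_line.
Qed.

Lemma dim_span2 (u v : 'rV['F_2]_3) :
  (\dim <<[:: u; v]>> == 2%N) = [&& u != 0, v != 0 & u != v].
Proof.
rewrite -[2%N]/(size [:: u; v]) -[_ == _]/(free _) free_cons seq1_free.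
by rewrite span_seq1 in_line2 negb_or andbAC -andbA.
Qed.

Lemma vpick_line (U : {vspace 'rV['F_2]_3}) :
  \dim U = 1%N -> U = <[vpick U]>%VS /\ vpick U != 0.
Proof.
move=> dU; have U0 : vpick U != 0 by rewrite vpick0 -dimv_eq0 dU.
split=> //; apply/esym/eqP; rewrite eqEdim -memvE memv_pick dU.
by rewrite dim_vline U0.
Qed.

Lemma line_vpick (u : 'rV['F_2]_3) : u != 0 -> vpick <[u]>%VS = u.
Proof.
move=> u0; have /vpick_line[e p0] : \dim <[u]> = 1%N by rewrite dim_vline u0.
by have := memv_pick <[u]>%VS; rewrite in_line2 (negPf p0) => /eqP.
Qed.

Definition bits (r : 'rV['F_2]_3) : vec :=
  (r 0 0 != 0, r 0 1 != 0, r 0 (inord 2) != 0).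

Lemma bits_morph : {morph bits : r s / r + s}.
Proof.
have D (x y : 'F_2) : (x + y != 0) = (x != 0) (+) (y != 0).
  by case: (F2_cases x) => ->; case: (F2_cases y) => ->.
by move=> r s; rewrite /bits !mxE !D.
Qed.

Lemma bits_inj : injective bits.
Proof.
have D (x y : 'F_2) : (x != 0) = (y != 0) -> x = y.
  by case: (F2_cases x) => ->; case: (F2_cases y) => ->.
move=> r s [/D e0 /D e1 /D e2]; apply/rowP => j.
have [e|[e|e]] : j = 0 \/ j = 1 \/ j = inord 2.
  by case: j => [[|[|[|j]]] lt] //; [left | right; left | right; right];
    apply/val_inj; rewrite //= inordK.
all: by rewrite e.
Qed.

Lemma card_iso_PG22 P : iso_PG22 P -> #|P| = 7%N.
Proof.
case=> f [fP f_inj f_onto _].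
have dim1 (v : 'rV['F_2]_3) : v != 0 -> \dim <[v]> = 1%N.
  by move=> v0; rewrite dim_vline v0.
have -> : P = [set f <[v]>%VS | v : 'rV['F_2]_3 in [set v | v != 0]].
  apply/setP => X; apply/idP/imsetP => [/f_onto[U dU <-]|[v + ->]].
    by have [eU U0] := vpick_line dU; exists (vpick U); rewrite ?inE -?eU.
  by rewrite inE => /dim1/fP.
rewrite card_in_imset => [|v w].
  by rewrite cardsE (cardC1 (0 : 'rV['F_2]_3)) card_mx card_ord.
rewrite !inE => v0 w0 /f_inj e.
by rewrite -(line_vpick v0) e ?dim1 // line_vpick.
Qed.

(** The points of PG(2,2) are the vector lines of F_2^3, and each of them is sent
    to the image under [g] of its nonzero vector. *)
Lemma fano_plane_span (g : vec -> {set 'I_15}) :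
  xor_morph g -> (forall p, p != 0 -> g p \in points) ->
  fano_plane (g @: nonzero vec).
Proof.
move=> gD g8; pose G r := g (bits r).
have GD r s : G (r + s) = symdiff (G r) (G s) by rewrite /G bits_morph gD.
have g_inj : injective g.
  apply: xor_morph_inj => // p /g8; rewrite inE.
  by apply: contraTneq => ->; rewrite cards0.
have G_inj : injective G by move=> r s /g_inj/bits_inj.
have bits0 : bits 0 = 0 by rewrite /bits !mxE.
have bits_eq0 r : (bits r == 0) = (r == 0) by rewrite -bits0 (inj_eq bits_inj).
have [bits' bitsK bits'K] : bijective bits.
  apply: inj_card_bij bits_inj _.
  by rewrite card_vec card_mx card_ord.
have inP X : reflect (exists2 r, r != 0 & X = G r) (X \in g @: nonzero vec).
  apply: (iffP imsetP) => [[p p0 ->]|[r r0 ->]]; last first.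
    by exists (bits r); rewrite // inE bits_eq0.
  by exists (bits' p); rewrite /G ?bits'K // -bits_eq0 bits'K; rewrite inE in p0.
have Pg r : r != 0 -> G r \in g @: nonzero vec by move=> r0; apply/inP; exists r.
have P8 X : X \in g @: nonzero vec -> X \in points.
  by case/imsetP=> p; rewrite inE => /g8 + ->.
have r2 r s : (r + s == 0) = (r == s :> 'rV['F_2]_3).
  by rewrite -bits_eq0 bits_morph vec_addr_eq0 (inj_eq bits_inj).
have join r s : joining_line (G r) (G s) = [set G r; G s; G (r + s)].
  by rewrite GD.
have line_join r s : r != 0 -> s != 0 -> r != s -> line (joining_line (G r) (G s)).
  move=> r0 s0 rs; apply/exists_inP; exists (G r); first exact/P8/Pg.
  apply/exists_inP; exists (G s); first exact/P8/Pg.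
  by rewrite (inj_eq G_inj) rs -GD P8 ?Pg ?r2 //=.
split.
  rewrite /singular /subspace; apply/andP; split; first (apply/andP; split).
  - exact/subsetP.
  - apply/forall_inP => _ /inP[r r0 ->]; apply/forall_inP => _ /inP[s s0 ->].
    apply/implyP => /andP[rs _]; rewrite (inj_eq G_inj) in rs.
    apply/subsetP => X; rewrite join !inE -orbA.
    by case/or3P=> /eqP->; apply: Pg; rewrite ?r2.
  - apply/forall_inP => _ /inP[r r0 ->]; apply/forall_inP => _ /inP[s s0 ->].
    apply/implyP; rewrite (inj_eq G_inj) => rs.
    apply/existsP; exists (joining_line (G r) (G s)).
    by rewrite line_join // !inE !eqxx orbT.
exists (fun U => G (vpick U)); split.
- by move=> U /vpick_line[_ U0]; apply: Pg.
- move=> U V /vpick_line[eU _] /vpick_line[eV _] /G_inj e.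
  by rewrite eU eV e.
- move=> _ /inP[r r0 ->]; exists <[r]>%VS; first by rewrite dim_vline r0.
  by rewrite line_vpick.
move=> L sLP; split=> [/exists_inP[X pX /exists_inP[Y pY]]|[W dW LW]].
  case/and3P=> nXY pXY /eqP eL; move: sLP; rewrite {L}eL => sLP.
  have /inP[r r0 eX] : X \in g @: nonzero vec.
    by apply: (subsetP sLP); rewrite !inE eqxx.
  have /inP[s s0 eY] : Y \in g @: nonzero vec.
    by apply: (subsetP sLP); rewrite !inE eqxx orbT.
  have rs : r != s by apply: contraNneq nXY => e; rewrite eX eY e.
  exists <<[:: r; s]>>%VS; first by apply/eqP; rewrite dim_span2 r0 s0.
  move=> U /vpick_line[eU U0].
  rewrite [in RHS]eU -memvE in_span2 (negPf U0) eX eY join !inE.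
  by rewrite !(inj_eq G_inj) -orbA.
have [u [v eW]] : exists u v, W = <<[:: u; v]>>%VS.
  have := span_basis (vbasisP W); have : size (vbasis W) = 2%N by rewrite size_tuple.
  by case: (tval (vbasis W)) => [|u [|v []]] // _ <-; exists u, v.
have /and3P[u0 v0 uv] : [&& u != 0, v != 0 & u != v].
  by rewrite -dim_span2 -eW dW.
suff -> : L = joining_line (G u) (G v) by exact: line_join.
have sJP : joining_line (G u) (G v) \subset g @: nonzero vec.
  apply/subsetP => X; rewrite join !inE -orbA.
  by case/or3P=> /eqP->; apply: Pg; rewrite ?r2.
apply/setP => X; have [/inP[x x0 ->]|nPX] := boolP (X \in g @: nonzero vec).
  have := LW <[x]>%VS; rewrite line_vpick // dim_vline x0 => ->//.
  by rewrite -memvE eW in_span2 (negPf x0) join !inE !(inj_eq G_inj) -orbA.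
by rewrite (contraNF (subsetP sLP X) nPX) (contraNF (subsetP sJP X) nPX).
Qed.

Lemma fano_plane_in C P X Y :
  fano_in C P -> X \in P -> Y \in P -> X != Y -> line_in P (joining_line X Y).
Proof.
case=> [[/andP[/andP[/subsetP sP /forall_inP subP] /forall_inP colP] _] _] PX PY nXY.
have /forall_inP/(_ Y PY) := subP X PX; have /forall_inP/(_ Y PY) := colP X PX.
rewrite nXY /= => -> /= sJ; rewrite /line_in sJ andbT.
apply/exists_inP; exists X; first exact: sP.
apply/exists_inP; exists Y; first exact: sP.
by rewrite nXY eqxx sP // (subsetP sJ) // !inE eqxx !orbT.
Qed.

(** A Fano plane has 7 points, so some [Y] in it is none of [X], [O] and
    [symdiff X O]; take the line through [X] and [Y]. *)
Lemma fano_line_avoiding C P O X :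
  fano_in C P -> X \in P -> X != O ->
  exists L, [/\ line_in C L, L \subset P, X \in L & O \notin L].
Proof.
move=> fP PX nXO; have [[_ isoP] sPC] := fP.
have /subsetPn[Y PY] : ~~ (P \subset [set X; O; symdiff X O]).
  apply/negP => /subset_leq_card; rewrite card_iso_PG22 // setUC cardsU1 cards2.
  by case: (_ \notin _); case: (_ != _).
rewrite !inE !negb_or -andbA => /and3P[nYX nYO nYXO].
have nXY : X != Y by rewrite eq_sym.
have /andP[lL sL] := fano_plane_in fP PX PY nXY.
exists (joining_line X Y); rewrite /line_in lL sL (subset_trans sL) //.
split; rewrite ?inE ?eqxx //.
rewrite [O == X]eq_sym [O == Y]eq_sym (negPf nXO) (negPf nYO) /=.
by apply: contraNneq nYXO => ->; rewrite symdiffK.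
Qed.

(** * The four types exclude each other *)

Definition typeC (k : kind) : {set {set 'I_15}} -> Prop :=
  match k with
  | Linear => typeC1 | Pencil => typeC2 | Single => typeC3 | Free => typeC4
  end.

(** If all points are centers, every point [Y] is joined inside [C] to a point
    [X] outside [P1]. This line lies in [P2] or [P3], so these two planes cover
    [C], which is impossible for 14 points. *)
Lemma typeC12_disjoint (C : {set {set 'I_15}}) :
  #|C| = 15%N -> typeC1 C -> typeC2 C -> False.
Proof.
move=> cC [_ allC] [P1 [P2 [P3 [[f1 f2 f3] _ eC _ lines]]]].
have [[s1 i1] [s2 i2] [s3 i3]] := And3 f1 f2 f3.
have sC : C \subset points.
  rewrite eC !subUset; case/andP: s1 => /andP[-> _] _.
  by case/andP: s2 => /andP[-> _] _; case/andP: s3 => /andP[-> _] _.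
have /subsetPn[X CX nP1X] : ~~ (C \subset P1).
  by apply/negP => /subset_leq_card; rewrite cC card_iso_PG22.
have /subset_leq_card : C \subset P2 :|: P3.
  apply/subsetP => Y CY; have [->|nYX] := eqVneq Y X.
    by move: CX; rewrite eC -setUA inE (negPf nP1X).
  have /andP[_ /forall_inP/(_ Y)] := allC X CX; rewrite !inE nYX => /(_ CY) sJ.
  have lJ : line_in C (joining_line Y X).
    rewrite /line_in sJ andbT; apply/exists_inP; exists Y; first exact: (subsetP sC).
    apply/exists_inP; exists X; first exact: (subsetP sC).
    rewrite nYX eqxx andbT; apply: (subsetP sC); apply: (subsetP sJ).
    by rewrite !inE eqxx !orbT.
  have [JY JX] : Y \in joining_line Y X /\ X \in joining_line Y X.
    by rewrite !inE !eqxx orbT.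
  case: (lines _ lJ) => /subsetP sJP; last by rewrite sJP ?orbT.
    by rewrite (sJP X JX) in nP1X.
  by rewrite sJP.
rewrite cC => /leq_trans/(_ (leq_card_setU P2 P3).1).
by rewrite !card_iso_PG22.
Qed.

Lemma typeC1_many_centers (C : {set {set 'I_15}}) O :
  #|C| = 15%N -> typeC1 C -> (forall O', center_point C O' -> O' = O) -> False.
Proof.
move=> cC [_ allC] uO; have /subset_leq_card : C \subset [set O].
  by apply/subsetP => X /allC/uO ->; rewrite inE.
by rewrite cC cards1.
Qed.

Lemma typeC2_many_centers C O :
  typeC2 C -> (forall O', center_point C O' -> O' = O) -> False.
Proof.
case=> [P1 [P2 [P3 [_ _ _ [lL cL] _]]]] uO.
have /exists_inP[X _ /exists_inP[Y _ /and3P[nXY _ /eqP eL]]] := lL.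
have cX : center_point C X by apply: cL; rewrite eL; rewrite !inE eqxx.
have cY : center_point C Y by apply: cL; rewrite eL; rewrite !inE eqxx orbT.
by rewrite (uO X cX) (uO Y cY) eqxx in nXY.
Qed.

(** A Fano plane contains lines that avoid any given point. *)
Lemma typeC34_disjoint C : typeC3 C -> typeC4 C -> False.
Proof.
case=> [P [_ [[fP _] _ _ _]]] [O [_ _ lines]].
have /subsetPn[X PX nXO] : ~~ (P \subset [set O]).
  have [[_ iP] _] := fP.
  by apply/negP => /subset_leq_card; rewrite card_iso_PG22 // cards1.
rewrite inE in nXO.
have [L [lL _ _ nLO]] := fano_line_avoiding fP PX nXO.
by rewrite (lines L lL) in nLO.
Qed.

Lemma typeC_unique (C : {set {set 'I_15}}) k k' :
  #|C| = 15%N -> typeC k C -> typeC k' C -> k = k'.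
Proof.
move=> cC.
have d12 := typeC12_disjoint cC; have d34 := @typeC34_disjoint C.
have d13 : typeC1 C -> typeC3 C -> False.
  by move=> t1 [P [O [_ [_ uO] _ _]]]; apply: typeC1_many_centers cC t1 uO.
have d14 : typeC1 C -> typeC4 C -> False.
  by move=> t1 [O [_ uO _]]; apply: typeC1_many_centers cC t1 uO.
have d23 : typeC2 C -> typeC3 C -> False.
  by move=> t2 [P [O [_ [_ uO] _ _]]]; apply: typeC2_many_centers t2 uO.
have d24 : typeC2 C -> typeC4 C -> False.
  by move=> t2 [O [_ uO _]]; apply: typeC2_many_centers t2 uO.
by case: k; case: k' => //= t t'; exfalso; auto.
Qed.

(** * The type of a clique in normal form *)

(** Two points with inner traces [p] and [q] are on a line inside the clique. *)
Definition aligned (k : kind) (p q : vec) : bool :=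
  twist k (p + q) == twist k p + twist k q.

Lemma dotD p q c : dot (p + q) c = dot p c (+) dot q c.
Proof.
move: p q c => [[p1 p2] p3] [[q1 q2] q3] [[c1 c2] c3]; rewrite /dot /=.
by case: p1; case: p2; case: p3; case: q1; case: q2; case: q3;
   case: c1; case: c2; case: c3.
Qed.

Lemma dot_inj p q : (forall c, dot p c = dot q c) -> p = q.
Proof.
move=> e; move: (e (true, false, false)) (e (false, true, false)) (e (false, false, true)).
move: p q {e} => [[p1 p2] p3] [[q1 q2] q3]; rewrite /dot /= !andbT !andbF !addbF.
by rewrite !addFb => -> -> ->.
Qed.

Lemma dotp0 p : dot p 0 = false.
Proof. by rewrite /dot !andbF. Qed.

Lemma dot0p c : dot 0 c = false.
Proof. by []. Qed.

Lemma twist0 k : twist k 0 = 0.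
Proof. by case: k. Qed.

Section NormalForm.
Variables (kappa : 'I_15 -> bool * vec) (k : kind) (C : {set {set 'I_15}}).
Hypotheses (k_inj : injective kappa) (k0 : forall i, kappa i != (false, 0)).
Hypotheses (eC : C = pt kappa k @: nonzero (vec * bool)).
Hypotheses (mC : maxset clique C).
Let pt := pt kappa k.

Let cC : clique C. Proof. by case/maxsetP: mC. Qed.

Lemma in_pt_outer p c i :
  kappa i = (true, c) -> (i \in pt p) = dot p.1 c (+) p.2.
Proof. by move=> e; rewrite in_set e. Qed.

Lemma in_pt_inner p c i :
  kappa i = (false, c) -> (i \in pt p) = dot (twist k p.1) c.
Proof. by move=> e; rewrite in_set e. Qed.

Lemma pt_additive p q :
  aligned k p.1 q.1 -> symdiff (pt p) (pt q) = pt (p + q).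
Proof.
move=> /eqP al; apply/setP => i; rewrite in_symdiff.
case e : (kappa i) => [[] c].
  by rewrite !(in_pt_outer _ e) dotD addbACA.
by rewrite !(in_pt_inner _ e) al dotD.
Qed.

(** Inside the center the traces add up in any case, which forces [r = p + q];
    outside, the equation says that [twist k] is additive on [p.1] and [q.1]. *)
Lemma pt_sum p q r : symdiff (pt p) (pt q) = pt r -> r = p + q /\ aligned k p.1 q.1.
Proof.
move=> e; have onto := coordinates_onto k_inj k0.
have eO c : dot r.1 c (+) r.2 = dot (p.1 + q.1) c (+) (p + q).2.
  have [//|i ei] := onto (true, c).
  by rewrite -(in_pt_outer r ei) -e in_symdiff !(in_pt_outer _ ei) addbACA dotD.
have e2 : r.2 = (p + q).2 by have := eO 0; rewrite !dotp0.
have e1 : r.1 = p.1 + q.1.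
  by apply: dot_inj => c; have := eO c; rewrite e2 => /addIb.
split; first by move: e1 e2; case: (r) => r1 r2 /= -> ->.
rewrite /aligned -e1; apply/eqP/dot_inj => c.
have [->|c0] := eqVneq c 0; first by rewrite !dotp0.
have [|i ei] := onto (false, c); first by rewrite xpair_eqE.
by rewrite -(in_pt_inner r ei) -e in_symdiff !(in_pt_inner _ ei) dotD.
Qed.

Lemma pt0 : pt 0 = set0.
Proof.
apply/setP => i; rewrite in_set in_set0 twist0.
by case: ifP => _; rewrite dot0p.
Qed.

Lemma pair_sum_eq0 (p q : vec * bool) : (p + q == 0) = (p == q).
Proof. by move: p q => [[[[] []] []] []] [[[[] []] []] []]. Qed.

Lemma pt_inj : injective pt.
Proof.
move=> p q e; have [] := @pt_sum p q 0; first by rewrite e symdiffXX pt0.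
by move=> /esym/eqP; rewrite pair_sum_eq0 => /eqP.
Qed.

Lemma pt_in_clique p : (pt p \in C) = (p != 0).
Proof. by rewrite eC mem_imset ?in_set //; exact: pt_inj. Qed.

Lemma cliqueP X : reflect (exists2 p, p != 0 & X = pt p) (X \in C).
Proof.
rewrite eC; apply: (iffP imsetP) => [[p + ->]|[p p0 ->]].
  by rewrite in_set; exists p.
by exists p; rewrite ?in_set.
Qed.

Lemma joining_line_sub p q :
  p != 0 -> q != 0 -> aligned k p.1 q.1 -> p != q ->
  joining_line (pt p) (pt q) \subset C.
Proof.
move=> p0 q0 al npq; rewrite /joining_line pt_additive //.
rewrite !subUset !sub1set !pt_in_clique pair_sum_eq0.
by rewrite p0 q0.
Qed.

Lemma center_pt p :
  p != 0 -> (forall q, aligned k p.1 q) -> center_point C (pt p).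
Proof.
move=> p0 al; rewrite /center_point pt_in_clique p0; apply/forall_inP => X.
rewrite in_setD1 => /andP[+ /cliqueP[q q0 eX]]; rewrite eX (inj_eq pt_inj) => npq.
by apply: joining_line_sub; rewrite // /aligned addrC [_ + twist k p.1]addrC; apply: al.
Qed.

Lemma center_pt_aligned p c : center_point C (pt p) -> aligned k p.1 c.
Proof.
case/andP=> _ /forall_inP/(_ (pt (c, false))).
have [->|c0] := eqVneq c 0; first by rewrite /aligned twist0 !addr0.
have [->|nc] := eqVneq c p.1; first by rewrite /aligned !vec_addrr twist0.
have np : (c, false) != p by apply: contraNneq nc => <-.
rewrite in_setD1 (inj_eq pt_inj) np pt_in_clique -pair_eqE /= negb_and c0 /= => /(_ isT).
move=> /subsetP/(_ (symdiff (pt (c, false)) (pt p))).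
rewrite in_setU set11 orbT => /(_ isT)/cliqueP[r _ /pt_sum[_]].
by rewrite /aligned addrC [twist k c + _]addrC.
Qed.

Lemma line_in_normal_form L :
  line_in C L ->
  exists p q, [/\ [/\ p != 0, q != 0 & p != q], aligned k p.1 q.1
                & L = [set pt p; pt q; pt (p + q)]].
Proof.
case/andP=> /exists_inP[X _ /exists_inP[Y _ /and3P[nXY _ /eqP eL]]].
rewrite eL !subUset !sub1set => /andP[/andP[/cliqueP[p p0 eX] /cliqueP[q q0 eY]] /cliqueP[r r0 eXY]].
move: nXY eXY; rewrite eX eY (inj_eq pt_inj) => npq /pt_sum[_ al].
by exists p, q; rewrite /joining_line pt_additive.
Qed.

Lemma pt_points p : p != 0 -> pt p \in points.
Proof. by rewrite -pt_in_clique; have /andP[/subsetP sC _] := cC; exact: sC. Qed.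

(** The nonzero vectors of the span of [(u, 0)], [(v, 0)] and the center
    [(0, 1)]. *)
Definition plane_coords (u v : vec) : {set vec * bool} :=
  [set p : vec * bool | (p != 0) && (p.1 \in [:: 0; u; v; u + v])].

Lemma fano_plane_coords u v :
  injective (comb u v) ->
  (forall w w', aligned k (comb u v w) (comb u v w')) ->
  fano_in C (pt @: plane_coords u v).
Proof.
move=> uv_inj al; pose lift3 (p : vec) : vec * bool := (comb u v p.1, p.2).
have lift0 p : (lift3 p == 0) = (p == 0).
  have comb0 w : (comb u v w == 0) = (w == 0).
    by rewrite -(inj_eq uv_inj) /comb /= addr0.
  by case: p => w z; rewrite -!pair_eqE /= comb0.
have -> : plane_coords u v = lift3 @: nonzero vec.
  apply/setP => p; rewrite in_set.
  apply/andP/imsetP => [[p0 pw]|[q + ->]]; last first.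
    rewrite in_set -lift0 => ->; split=> //.
    rewrite !inE; case: q => [[[] []] z];
    by rewrite /lift3 /comb /= ?addr0 ?add0r ?eqxx ?orbT.
  have [w ew] : exists w, p.1 = comb u v w.
    move: pw; rewrite !inE => /or4P[]/eqP->.
    - by exists (false, false); rewrite /comb /= addr0.
    - by exists (true, false); rewrite /comb /= addr0.
    - by exists (false, true); rewrite /comb /= add0r.
    - by exists (true, true).
  have ep : p = lift3 (w, p.2) by rewrite /lift3 -ew; case: (p).
  by exists (w, p.2); rewrite // in_set -lift0 -ep.
rewrite -imset_comp; split.
  apply: fano_plane_span => [p q|p p0]; last by apply: pt_points; rewrite lift0.
  rewrite /= pt_additive /=; last exact: al.
  congr (pt _); rewrite /lift3 -[(p + q).1]/(p.1 + q.1) comb_morph.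
  by [].
apply/subsetP => _ /imsetP[p + ->].
by rewrite in_set /= pt_in_clique lift0.
Qed.

(** The center that the normal form starts from. *)
Let O := pt (0, true).

Lemma apex_center : center_point C O.
Proof.
by apply: center_pt => // q; rewrite /aligned twist0 !add0r.
Qed.

(** In these two cases no nonzero vector is aligned with all others. *)
Lemma apex_unique_center O' :
  k = Single \/ k = Free -> center_point C O' -> O' = O.
Proof.
move=> kind_k cO'; have [CO' _] := andP cO'.
have /cliqueP[p p0 eO'] := CO'; rewrite eO' /O; congr pt.
rewrite eO' in cO'; have al c := center_pt_aligned c cO'.
move: p0 (al (true, false, false)) (al (false, true, false)) (al (false, false, true)).
case: kind_k => ->; rewrite /aligned;
  by move: p {eO' al cO'} => [[[[] []] []] []].
Qed.

Lemma normal_typeC1 : k = Linear -> typeC1 C.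
Proof.
move=> kL; have al p q : aligned k p q by rewrite /aligned kL.
have [_ maxC] := maxsetP mC; have /andP[sC colC] := cC.
split; last by move=> _ /cliqueP[p p0 ->]; apply: center_pt.
apply/maxsetP; split=> [|B /andP[/andP[sB _] colB]]; last first.
  by apply: maxC; rewrite /clique sB.
rewrite /singular /subspace sC colC !andbT /=.
apply/forall_inP => _ /cliqueP[p p0 ->]; apply/forall_inP => _ /cliqueP[q q0 ->].
apply/implyP => /andP[+ _]; rewrite (inj_eq pt_inj) => npq.
exact: joining_line_sub.
Qed.

Lemma normal_typeC4 : k = Free -> typeC4 C.
Proof.
move=> kF; exists O; split; first exact: apex_center.
  by move=> O' cO'; apply: apex_unique_center cO'; right.
move=> _ /line_in_normal_form[p [q [[p0 q0 npq] al ->]]].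
rewrite !in_setU !in_set1 !(inj_eq pt_inj) -orbA.
move: p0 q0 npq al; rewrite kF /aligned.
by move: p q => [[[[] []] []] []] [[[[] []] []] []].
Qed.

Lemma line_sub_plane u v p q :
  p \in plane_coords u v -> q \in plane_coords u v -> p + q \in plane_coords u v ->
  [set pt p; pt q; pt (p + q)] \subset pt @: plane_coords u v.
Proof. by move=> ? ? ?; rewrite !subUset !sub1set !imset_f. Qed.

(** The transposition [turn Single] fixes [(1, 1)] only, so [twist Single] is
    additive on the plane of [(1, 1, 0)] and [(0, 0, 1)]. A Fano plane inside
    the clique is the given one because each of its points other than [O] lies
    on one of its lines that avoid [O]. *)
Lemma normal_typeC3 : k = Single -> typeC3 C.
Proof.
move=> kS; pose P := pt @: plane_coords (true, true, false) (false, false, true).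
have fP : fano_in C P.
  apply: fano_plane_coords; rewrite ?kS.
    by move=> [[] []] [[] []].
  by move=> [[] []] [[] []].
have lines L : line_in C L -> L \subset P \/ O \in L.
  case/line_in_normal_form => [p [q [[p0 q0 npq] al ->]]].
  have : [&& p \in plane_coords (true, true, false) (false, false, true),
             q \in plane_coords (true, true, false) (false, false, true)
           & p + q \in plane_coords (true, true, false) (false, false, true)]
         || [|| (0, true) == p, (0, true) == q | (0, true) == p + q].
    rewrite !in_set; move: p0 q0 npq al; rewrite kS /aligned.
    by move: p q => [[[[] []] []] []] [[[[] []] []] []].
  case/orP => [/and3P[Pp Pq Ppq]|]; first by left; apply: line_sub_plane.
  by right; rewrite !in_setU !in_set1 !(inj_eq pt_inj) -orbA.
have PO : O \in P by rewrite imset_f // in_set.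
exists P, O; split=> //; last first.
  split; first exact: apex_center.
  by move=> O' cO'; apply: apex_unique_center cO'; left.
split=> // Q fQ; have [[_ iQ] _] := fQ; have [[_ iP] _] := fP.
apply/eqP; rewrite eqEcard !card_iso_PG22 // leqnn andbT; apply/subsetP => X QX.
have [->//|nXO] := eqVneq X O.
have [L [lL _ XL nOL]] := fano_line_avoiding fQ QX nXO.
by case: (lines L lL) => [/subsetP/(_ X XL)|]; rewrite ?(negPf nOL).
Qed.

(** The vector [t] is aligned with every vector, so that the planes of [t] with
    each of [u], [v], [u + v] carry Fano planes. They share [O] and the two
    points above [t]. *)
Lemma normal_typeC2 : k = Pencil -> typeC2 C.
Proof.
move=> kP; pose t : vec := (false, false, true).
pose D u := plane_coords u t; pose P u := pt @: D u.
pose u : vec := (true, false, false); pose v : vec := (false, true, false).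
pose w : vec := (true, true, false).
have fP : [/\ fano_in C (P u), fano_in C (P v) & fano_in C (P w)].
  by split; apply: fano_plane_coords; rewrite ?kP; move=> [[] []] [[] []].
have [[fu _] [fv _] [fw _]] := fP.
have eI : P u :&: P v :&: P w = pt @: (D u :&: D v :&: D w).
  by rewrite !imsetI // => ? ? _ _; apply: pt_inj.
exists (P u), (P v), (P w); split=> //.
- rewrite /P !(inj_eq (imset_inj pt_inj)).
  split; apply/eqP => /setP.
  + by move/(_ (u, false)); rewrite !in_set.
  + by move/(_ (u, false)); rewrite !in_set.
  + by move/(_ (v, false)); rewrite !in_set.
- rewrite /P -!imsetU eC; suff <- : nonzero (vec * bool) = D u :|: D v :|: D w by [].
  by apply/setP => p; rewrite !in_set; move: p => [[[[] []] []] []].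
- have e : D u :&: D v :&: D w = [set (0 : vec, true); (t, false); (t, true)].
    apply/setP => p; rewrite !(in_setI, in_setU, in_set1, in_set).
    by move: p => [[[[] []] []] []].
  rewrite eI e; split.
    have fPu : fano_in C (P u) by have [] := fP.
    have /(fano_plane_in fPu) : pt (0, true) \in P u by rewrite imset_f // in_set.
    move=> /(_ (pt (t, false))); rewrite imset_f ?in_set // (inj_eq pt_inj).
    move=> /(_ isT isT)/andP[+ _]; rewrite /joining_line pt_additive ?kP //.
    by rewrite !imsetU !imset_set1.
  move=> _ /imsetP[p + ->]; rewrite !in_setU !in_set1 => pI.
  apply: center_pt; first by move: pI => /orP[/orP[]|]/eqP ->.
  move=> q; rewrite /aligned kP; move: pI => /orP[/orP[]|]/eqP ->;
    by move: q => [[[] []] []].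
- move=> _ /line_in_normal_form[p [q [[p0 q0 npq] al ->]]].
  have : [|| [&& p \in D u, q \in D u & p + q \in D u],
             [&& p \in D v, q \in D v & p + q \in D v]
           | [&& p \in D w, q \in D w & p + q \in D w]].
    rewrite !in_set; move: p0 q0 npq al; rewrite kP /aligned.
    by move: p q => [[[[] []] []] []] [[[[] []] []] []].
  by case/or3P=> /and3P[? ? ?]; [apply: Or31 | apply: Or32 | apply: Or33];
    apply: line_sub_plane.
Qed.

End NormalForm.

Lemma normal_form_typeC kappa k C :
  normal_form kappa k C -> maxset clique C -> typeC k C.
Proof.
case=> k_inj k0 eC mC; case: k eC => eC /=.
- exact: (normal_typeC1 k_inj k0 eC mC).
- exact: (normal_typeC2 k_inj k0 eC mC).
- exact: (normal_typeC3 k_inj k0 eC mC).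
- exact: (normal_typeC4 k_inj k0 eC).
Qed.

Theorem theorem1 :
  (forall C : {set {set 'I_15}}, centered_max_clique15 C ->
     typeC1 C \/ typeC2 C \/ typeC3 C \/ typeC4 C)
  /\
  (forall C C' : {set {set 'I_15}},
     centered_max_clique15 C -> centered_max_clique15 C' ->
     (typeC1 C /\ typeC1 C') \/ (typeC2 C /\ typeC2 C') \/
     (typeC3 C /\ typeC3 C') \/ (typeC4 C /\ typeC4 C') ->
     exists s : {perm 'I_15}, perm_image s C = C').
Proof.
have normal C : centered_max_clique15 C ->
    exists kappa k, normal_form kappa k C /\ typeC k C.
  move=> cC; have [kappa [k nC]] := normal_form_exists cC.
  exists kappa, k; split=> //; apply: normal_form_typeC nC _.
  by case/andP: cC.
split=> [C /normal[_ [k [_ tC]]]|C C' cC cC' tCC'].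
  by case: k tC => /= tC; auto.
have [kappa [k [nC tC]]] := normal C cC.
have [kappa' [k' [nC' tC']]] := normal C' cC'.
have /and3P[_ /eqP card_C _] := cC; have /and3P[_ /eqP card_C' _] := cC'.
have [i [ti ti']] : exists i, typeC i C /\ typeC i C'.
  by case: tCC' => [|[|[|]]] tt;
    [exists Linear | exists Pencil | exists Single | exists Free].
have e := typeC_unique card_C tC ti; have e' := typeC_unique card_C' tC' ti'.
by rewrite e in nC; rewrite e' in nC'; apply: normal_form_perm nC nC'.
Qed.
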